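(* Fix $x\in\mathbb{R}\setminus[0,1]$. Then there exist $n\ge1$ and $A,B\in\mathbb{M}_n$ for which there do not exist isometries $U,V,S,T\in\mathbb{M}_{2n,n}$ satisfying $$|A\oplus B|^2=U\,|A\nabla_xB|^2U^*+V\,|B\nabla_xA|^2V^*+x(1-x)\Bigl\{S\,|A-B|^2S^*+T\,|A-B|^2T^*\Bigr\}.$$ In fact, such $A,B$ exist already for $n=1$.
   Context: $\mathbb{M}_{m,n}$ is the space of $m\times n$ complex matrices, $\mathbb{M}_n=\mathbb{M}_{n,n}$; $|Z|=(Z^*Z)^{1/2}$. $A\nabla_xB:=(1-x)A+xB$ for $x\in\mathbb{R}$. $A\oplus B$ is the block-diagonal matrix in $\mathbb{M}_{2n}$. An isometry in $\mathbb{M}_{2n,n}$ is a matrix $V$ with $V^*V=I_n$. *)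

(* Defs.v *)
From mathcomp Require Import all_boot all_order all_algebra.
From mathcomp Require Import complex reals.

Set Implicit Arguments.
Unset Strict Implicit.
Unset Printing Implicit Defensive.

Import GRing.Theory Num.Theory.
Local Open Scope ring_scope.
Local Open Scope sesquilinear_scope.
Local Open Scope complex_scope.

Section Defs.
Variable R : realType.
Local Notation C := R[i].

(* Square root of a positive semidefinite matrix, by functional calculus on
   the unitary diagonalization [A = invmx P *m diag_mx d *m P] provided by
   [spectralmx]; the value is meaningless when [A] is not normal. *)
Definition mxsqrt n (A : 'M[C]_n) : 'M[C]_n :=
  invmx (spectralmx A) *m diag_mx (map_mx sqrtC (spectral_diag A))
    *m spectralmx A.

Definition absmx m n (Z : 'M[C]_(m, n)) : 'M[C]_n := mxsqrt (Z^t* *m Z).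

Definition nabla (x : R) m n (A B : 'M[C]_(m, n)) : 'M[C]_(m, n) :=
  (1 - x)%:C *: A + x%:C *: B.

Definition dsummx n (A B : 'M[C]_n) : 'M[C]_(n + n) := block_mx A 0 0 B.

(* Not [unitarymx], which for a rectangular [V] asks that [V *m V^t* = 1]. *)
Definition isometrymx m n (V : 'M[C]_(m, n)) : Prop := V^t* *m V = 1%:M.

Definition isometric_decomposition (x : R) n (A B : 'M[C]_n)
    (U V S T : 'M[C]_(n + n, n)) : Prop :=
  absmx (dsummx A B) ^+ 2 =
    U *m absmx (nabla x A B) ^+ 2 *m U^t*
    + V *m absmx (nabla x B A) ^+ 2 *m V^t*
    + (x * (1 - x))%:C *: (S *m absmx (A - B) ^+ 2 *m S^t*
                           + T *m absmx (A - B) ^+ 2 *m T^t*).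

End Defs.

(* Main.v *)
Require Import Defs.
From mathcomp Require Import all_boot all_order all_algebra.
From mathcomp Require Import complex reals.

Local Open Scope ring_scope.
Local Open Scope complex_scope.

(** Take the scalars [a = x] and [b = x - 1].  Then [(1 - x) a + x b = 0], so
    the first term on the right vanishes, while [a - b = 1].  A row vector
    [w != 0] with [w V = 0] exists because [V] is 2x1; evaluating the quadratic
    form at [w] gives [x^2 |w1|^2 + (x - 1)^2 |w2|^2 > 0] on the left, but
    [x (1 - x)] times a nonnegative number on the right, and [x (1 - x) < 0]. *)

Import Order.TTheory GRing.Theory Num.Theory.
Local Open Scope sesquilinear_scope.

Lemma trmxC_mul (C : numClosedFieldType) m n p (A : 'M[C]_(m, n))
  (B : 'M[C]_(n, p)) : (A *m B)^t* = B^t* *m A^t*.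
Proof. by rewrite trmx_mul map_mxM. Qed.

(** [Z^t* *m Z] is normal, hence equal to its unitary diagonalization; in the square the inner
    unitary factors cancel and each [sqrtC] squares back to its eigenvalue. *)
Lemma absmx_sqr (R : realType) m n (Z : 'M[R[i]]_(m, n)) :
  absmx Z ^+ 2 = Z^t* *m Z.
Proof.
have nZ : Z^t* *m Z \is normalmx.
  by apply/normalmxP; rewrite trmxC_mul trmxCK.
rewrite [RHS](orthomx_spectralP nZ) expr2 /absmx /mxsqrt -mulmxE.
rewrite !mulmxA mulmxK ?spectral_unit// -(mulmxA (invmx _) (diag_mx _) (diag_mx _)) mulmx_diag.
congr (_ *m diag_mx _ *m _); apply/rowP => j.
by rewrite !mxE -expr2 sqrtCK.
Qed.

(** Turns the quadratic form of a Gram matrix into a squared norm, whose sign is known. *)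
Lemma dotmx_gram (C : numClosedFieldType) m n (w : 'rV[C]_n)
  (Z : 'M[C]_(n, m)) : (w *m (Z *m Z^t*) *m w^t*) 0 0 = dotmx (w *m Z) (w *m Z).
Proof. by rewrite dotmxE trmxC_mul !mulmxA. Qed.

Lemma exists_left_null (F : fieldType) m n (A : 'M[F]_(m, n)) :
  (n < m)%N -> exists2 w : 'rV[F]_m, w != 0 & w *m A = 0.
Proof.
move=> ltnm; have : kermx A != 0.
  by rewrite -mxrank_eq0 mxrank_ker subn_eq0 -ltnNge (leq_ltn_trans (rank_leq_col A)).
by case/rowV0Pn => w /sub_kermxP wA w0; exists w.
Qed.

(** A nonzero [w] with [w *m V = 0] kills the [V] term whatever [G] is. At [w] the left side is the
    squared norm of [w *m D^t*], positive by invertibility of [D]; what remains on the right is [c]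
    times a sum of squared norms. *)
Lemma gram_unit_neq_thin_sub_gram (C : numClosedFieldType) m n p (D : 'M[C]_m)
  (V : 'M[C]_(m, n)) (G : 'M[C]_n) (S T : 'M[C]_(m, p)) (c : C) :
  (n < m)%N -> D \in unitmx -> c <= 0 ->
  D^t* *m D <> V *m G *m V^t* + c *: (S *m S^t* + T *m T^t*).
Proof.
move=> ltnm Dunit c_le0 eqD.
have [w w0 wV] := exists_left_null _ _ _ V ltnm.
have DTunit : D^t* \in unitmx by rewrite map_unitmx unitmx_tr.
have wD : w *m D^t* != 0.
  by apply: contra w0 => /eqP e; rewrite -(mulmxK DTunit w) e mul0mx.
have := congr1 (fun M => (w *m M *m w^t*) 0 0) eqD => /=.
(* Reading the second [D] as the adjoint of [D^t*] gives the left side the shape [Z *m Z^t*]. *)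
rewrite -{2}(trmxCK D) dotmx_gram mulmxDr !mulmxA wV !mul0mx add0r.
rewrite -scalemxAr -scalemxAl [in RHS]mxE mulmxDr mulmxDl [in RHS]mxE.
rewrite !dotmx_gram => eqw.
have : 0 < dotmx (w *m D^t*) (w *m D^t*) by rewrite (dnorm_gt0 (@dotmx C m)).
by rewrite eqw le_gtF// mulr_le0_ge0// addr_ge0// (dnorm_ge0 (@dotmx C p)).
Qed.

Lemma no_scalar_isometric_decomposition (R : realType) (x : R) :
  ~~ (0 <= x <= 1) ->
  ~ exists U V S T : 'M[R[i]]_(1 + 1, 1),
      isometric_decomposition x x%:C%:M (x - 1)%:C%:M U V S T.
Proof.
move=> hx [U [V [S [T]]]].
have x0 : x != 0 by apply: contra hx => /eqP->; rewrite lexx ler01.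
have x1 : x - 1 != 0.
  by rewrite subr_eq0; apply: contra hx => /eqP->; rewrite lexx ler01.
have xx : x * (1 - x) <= 0.
  move: hx; rewrite negb_and -!ltNge => /orP[xlt|xgt].
    by rewrite nmulr_rle0// subr_ge0 (le_trans (ltW xlt)).
  by rewrite pmulr_rle0 ?subr_le0 ?ltW// (lt_trans ltr01).
rewrite /isometric_decomposition !absmx_sqr.
have -> : nabla x x%:C%:M (x - 1)%:C%:M = 0 :> 'M[R[i]]_1.
  rewrite /nabla !scale_scalar_mx -!rmorphM -raddfD -rmorphD /=.
  by rewrite -opprB mulNr mulrC addrC subrr !raddf0.
have -> : x%:C%:M - (x - 1)%:C%:M = 1%:M :> 'M[R[i]]_1.
  by rewrite -raddfB -rmorphB opprB addrC subrK.
have -> : (1%:M : 'M[R[i]]_1)^t* = 1%:M by rewrite trmx1 map_mx1.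
(* The [U] term disappears and the [S], [T] terms become bare Gram matrices; the middle factor of
   the [V] term plays the part of [G]. *)
rewrite !mulmx0 mul0mx add0r !mulmx1.
set D := dsummx _ _; set Y := nabla _ _ _ => eqD.
(* The determinant is [x * (x - 1)], nonzero since [x] is neither 0 nor 1. *)
have Dunit : D \in unitmx.
  rewrite unitmxE /D /dsummx det_ublock !det_scalar1.
  by rewrite -rmorphM unitfE fmorph_eq0 mulf_neq0.
have c_le0 : (x * (1 - x))%:C <= 0 :> R[i] by rewrite lecR.
exact: (gram_unit_neq_thin_sub_gram _ _ _ _ _ _ _ _ _ _ (ltnSn 1) Dunit c_le0 eqD).
Qed.

Theorem theorem1p27 (R : realType) (x : R) (hx : ~~ (0 <= x <= 1)) :
  (exists (n : nat) (A B : 'M[R[i]]_n), (1 <= n)%N /\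
     ~ (exists U V S T : 'M[R[i]]_(n + n, n),
          [/\ isometrymx U, isometrymx V, isometrymx S & isometrymx T] /\
          isometric_decomposition x A B U V S T))
  /\
  (exists A B : 'M[R[i]]_1,
     ~ (exists U V S T : 'M[R[i]]_(1 + 1, 1),
          [/\ isometrymx U, isometrymx V, isometrymx S & isometrymx T] /\
          isometric_decomposition x A B U V S T)).
Proof.
have noUVST := no_scalar_isometric_decomposition _ _ hx.
split; [exists 1%N|]; exists x%:C%:M, (x - 1)%:C%:M; [split=> //|];
  by move=> [U [V [S [T [_ dec]]]]]; apply: noUVST; exists U, V, S, T.
Qed.
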